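(* If $B$ is a right perfect bialgebra over a field $\Bbbk$, then $i_B\colon B\to B\oslash B$ is surjective and $p_B\colon (B\otimes B)^{\mathrm{co}B}\to B$ is injective.
   Context: A bialgebra is right perfect if its underlying algebra satisfies the descending chain condition on principal left ideals. For a bialgebra $B$ with counit $\varepsilon$ put $B^+=\ker(\varepsilon)$, $B\oslash B:=(B\otimes B)/\big((B\otimes B)\Delta(B^+)\big)$, $x\oslash y$ the class of $x\otimes y$, and $i_B\colon B\to B\oslash B$, $b\mapsto b\oslash 1$. Put $(B\otimes B)^{\mathrm{co}B}:=\{\sum_i x^i\otimes y_i\in B\otimes B \mid \sum_i x^i_1\otimes (y_i)_1\otimes x^i_2(y_i)_2=\sum_i x^i\otimes y_i\otimes 1\}$ and $p_B\colon (B\otimes B)^{\mathrm{co}B}\to B$, $\sum_i x^i\otimes y_i\mapsto\sum_i x^i\varepsilon(y_i)$. *)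

(* Defs.v *)
From HB Require Import structures.
From mathcomp Require Import all_boot all_order all_algebra sesquilinear.
From mathcomp Require Import boolp classical_sets functions finmap.
From mathcomp.multinomials Require Import monalg.

Set Implicit Arguments.
Unset Strict Implicit.
Unset Printing Implicit Defensive.

Import GRing.Theory.

Local Open Scope ring_scope.
Local Open Scope classical_set_scope.
Local Open Scope quotient_scope.

Section Mspan.
Context {R : comNzRingType} {V : lmodType R}.

Definition submodule (W : set V) : Prop :=
  W 0 /\ forall (a : R) (u v : V), W u -> W v -> W (a *: u + v).

Definition mspan (S : set V) : set V := smallest submodule S.

Lemma mspan_submodule (S : set V) : submodule (mspan S).
Proof.
split=> [W [[]] //|a u v Su Sv W WS].
by have [[_ WD] _] := WS; exact: WD (Su _ WS) (Sv _ WS).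
Qed.

Lemma sub_mspan (S : set V) : S `<=` mspan S.
Proof. by move=> x Sx W [_ SW]; exact: SW. Qed.

Lemma mspan_min (S W : set V) : submodule W -> S `<=` W -> mspan S `<=` W.
Proof. by move=> WM SW x Sx; exact: Sx. Qed.

Lemma mspan0 (S : set V) : mspan S 0.
Proof. by case: (mspan_submodule S). Qed.

Lemma mspanD (S : set V) u v : mspan S u -> mspan S v -> mspan S (u + v).
Proof.
by move=> Su Sv; rewrite -[u]scale1r; apply: (mspan_submodule S).2.
Qed.

Lemma mspanZ (S : set V) a u : mspan S u -> mspan S (a *: u).
Proof.
by move=> Su; rewrite -[_ *: u]addr0; apply: (mspan_submodule S).2 => //;
  exact: mspan0.
Qed.

Lemma mspanN (S : set V) u : mspan S u -> mspan S (- u).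
Proof. by move=> Su; rewrite -scaleN1r; exact: mspanZ. Qed.

End Mspan.

Section ModuleQuotient.
Context {R : comNzRingType} {V : lmodType R} (S : set V).

Definition mspan_eq : rel V := fun u v => `[< mspan S (u - v) >].

Lemma mspan_eq_is_equiv : equiv_class_of mspan_eq.
Proof.
split=> [x|x y|y x z].
- by apply/asboolP; rewrite subrr; exact: mspan0.
- by apply/asboolP/asboolP => /mspanN; rewrite opprB.
- by move=> /asboolP xy /asboolP yz; apply/asboolP;
    have := mspanD xy yz; rewrite addrA subrK.
Qed.

Canonical mspan_equiv := EquivRelPack mspan_eq_is_equiv.

(* The quotient of V by the submodule generated by S. *)
Definition mquot : Type := {eq_quot mspan_equiv}.

HB.instance Definition _ := Choice.on mquot.
HB.instance Definition _ := EqQuotient.on mquot.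

Definition mpi (v : V) : mquot := \pi_mquot v.

Lemma mpiP u v : mpi u = mpi v <-> mspan S (u - v).
Proof.
split=> [/eqquotP|Suv]; first by move=> /asboolP.
by apply/eqquotP/asboolP.
Qed.

Lemma mpiK (x : mquot) : mpi (repr x) = x.
Proof. by rewrite /mpi reprK. Qed.

Lemma repr_mpi v : mspan S (repr (mpi v) - v).
Proof. by apply/mpiP; rewrite mpiK. Qed.

Definition mquot_add (x y : mquot) : mquot := mpi (repr x + repr y).
Definition mquot_opp (x : mquot) : mquot := mpi (- repr x).
Definition mquot_scale (a : R) (x : mquot) : mquot := mpi (a *: repr x).

Lemma mpi_add u v : mquot_add (mpi u) (mpi v) = mpi (u + v).
Proof.
apply/mpiP; rewrite opprD addrACA; apply: mspanD; exact: repr_mpi.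
Qed.

Lemma mpi_opp u : mquot_opp (mpi u) = mpi (- u).
Proof.
by apply/mpiP; rewrite -opprD; apply: mspanN; exact: repr_mpi.
Qed.

Lemma mpi_scale a u : mquot_scale a (mpi u) = mpi (a *: u).
Proof. by apply/mpiP; rewrite -scalerBr; apply: mspanZ; exact: repr_mpi. Qed.

Lemma mquot_ind (P : mquot -> Prop) : (forall v, P (mpi v)) -> forall x, P x.
Proof. by move=> Ppi x; rewrite -[x]mpiK. Qed.

Lemma mquot_addA : associative mquot_add.
Proof.
elim/mquot_ind=> x; elim/mquot_ind=> y; elim/mquot_ind=> z.
by rewrite !mpi_add addrA.
Qed.

Lemma mquot_addC : commutative mquot_add.
Proof.
by elim/mquot_ind=> x; elim/mquot_ind=> y; rewrite !mpi_add addrC.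
Qed.

Lemma mquot_add0 : left_id (mpi 0) mquot_add.
Proof. by elim/mquot_ind=> x; rewrite mpi_add add0r. Qed.

Lemma mquot_addN : left_inverse (mpi 0) mquot_opp mquot_add.
Proof. by elim/mquot_ind=> x; rewrite mpi_opp mpi_add addNr. Qed.

HB.instance Definition _ := GRing.isZmodule.Build mquot
  mquot_addA mquot_addC mquot_add0 mquot_addN.

Lemma mpiD u v : mpi (u + v) = mpi u + mpi v.
Proof. by rewrite -mpi_add. Qed.

Lemma mquot_scaleA a b x :
  mquot_scale a (mquot_scale b x) = mquot_scale (a * b) x.
Proof. by elim/mquot_ind: x => x; rewrite !mpi_scale scalerA. Qed.

Lemma mquot_scale1 : left_id 1 mquot_scale.
Proof. by elim/mquot_ind=> x; rewrite mpi_scale scale1r. Qed.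

Lemma mquot_scaleDr : right_distributive mquot_scale +%R.
Proof.
move=> a; elim/mquot_ind=> x; elim/mquot_ind=> y.
by rewrite -mpiD !mpi_scale scalerDr mpiD.
Qed.

Lemma mquot_scaleDl x : {morph mquot_scale^~ x : a b / a + b}.
Proof.
by move=> a b; elim/mquot_ind: x => x; rewrite !mpi_scale scalerDl mpiD.
Qed.

HB.instance Definition _ := GRing.Zmodule_isLmodule.Build R mquot
  mquot_scaleA mquot_scale1 mquot_scaleDr mquot_scaleDl.

Lemma mpi_is_linear : linear mpi.
Proof. by move=> a u v; rewrite mpiD -mpi_scale. Qed.

HB.instance Definition _ := GRing.isLinear.Build R V mquot _ mpi mpi_is_linear.

End ModuleQuotient.

Section Tensor.
Context {R : comNzRingType}.

Section TensorDef.
Variables V W : lmodType R.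

Local Notation "v :* w" := (<< (v, w) >> : {malg R[(V * W)%type]}) (at level 40).

Definition tensor_rel : set {malg R[(V * W)%type]} :=
  [set x | exists v v' w, x = (v + v') :* w - v :* w - v' :* w] `|`
  [set x | exists v w w', x = v :* (w + w') - v :* w - v :* w'] `|`
  [set x | exists a v w, x = (a *: v) :* w - a *: (v :* w)] `|`
  [set x | exists a v w, x = v :* (a *: w) - a *: (v :* w)].

(* The free module on V * W modulo the bilinearity relations. *)
Definition tensor : Type := mquot tensor_rel.

HB.instance Definition _ := GRing.Lmodule.on tensor.

Definition tens (v : V) (w : W) : tensor := mpi tensor_rel << (v, w) >>.

Lemma tensDl v v' w : tens (v + v') w = tens v w + tens v' w.
Proof.
rewrite /tens -mpiD; apply/mpiP; apply: sub_mspan; left; left; left.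
by exists v, v', w; rewrite opprD addrA.
Qed.

Lemma tensDr v w w' : tens v (w + w') = tens v w + tens v w'.
Proof.
rewrite /tens -mpiD; apply/mpiP; apply: sub_mspan; left; left; right.
by exists v, w, w'; rewrite opprD addrA.
Qed.

Lemma tensZl a v w : tens (a *: v) w = a *: tens v w.
Proof.
rewrite /tens -linearZ; apply/mpiP; apply: sub_mspan; left; right.
by exists a, v, w.
Qed.

Lemma tensZr a v w : tens v (a *: w) = a *: tens v w.
Proof.
by rewrite /tens -linearZ; apply/mpiP; apply: sub_mspan; right; exists a, v, w.
Qed.

Lemma tens_is_bilinear : bilinear_for *:%R *:%R tens.
Proof.
by split=> [w a v v'|v a w w']; rewrite ?(tensDl, tensDr) ?(tensZl, tensZr).
Qed.

HB.instance Definition _ :=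
  bilinear_isBilinear.Build R V W tensor *:%R *:%R tens tens_is_bilinear.

Lemma tens_ind (P : tensor -> Prop) :
  (forall v w, P (tens v w)) -> (forall x y, P x -> P y -> P (x + y)) ->
  forall t, P t.
Proof.
move=> Pt PD; apply: mquot_ind => g.
rewrite (monalgE g) linear_sum /=.
elim/big_ind: _ => [|x y Px Py|k _].
- by have := Pt 0 0; rewrite -[X in tens X _](scale0r 0) tensZl scale0r.
- exact: PD.
- have -> : << g@_k *g k >> = g@_k *: << k >>.
    by apply/malgP => k'; rewrite mcoeffZ !mcoeffU mulrnAr mulr1.
  by rewrite linearZ; case: k => v w; rewrite -[X in P X]tensZl.
Qed.

End TensorDef.

Section FreeExtension.
Variables V W U : lmodType R.
Implicit Type f : V -> W -> U.

Definition free_ext f (g : {malg R[(V * W)%type]}) : U :=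
  \sum_(k <- msupp g) g@_k *: f k.1 k.2.

Lemma free_extEw f (g : {malg R[(V * W)%type]}) (D : {fset (V * W)%type}) :
  (msupp g `<=` D)%fset -> free_ext f g = \sum_(k <- D) g@_k *: f k.1 k.2.
Proof.
move=> sgD; rewrite /free_ext; apply/(big_fset_incl _ sgD) => k _ /mcoeff_outdom->.
by rewrite scale0r.
Qed.

Lemma free_ext_is_linear f : linear (free_ext f).
Proof.
move=> a g h; set D := (msupp g `|` msupp h)%fset.
have sgD : (msupp g `<=` D)%fset by exact: fsubsetUl.
have shD : (msupp h `<=` D)%fset by exact: fsubsetUr.
have sD : (msupp (a *: g + h)%R `<=` D)%fset.
  apply: (fsubset_trans (msuppD_le _ _)); apply/fsetSU; exact: msuppZ_le.
rewrite !(free_extEw _ sgD, free_extEw _ shD, free_extEw _ sD).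
rewrite scaler_sumr -big_split /=; apply: eq_bigr => k _.
by rewrite mcoeffD mcoeffZ scalerDl scalerA.
Qed.

HB.instance Definition _ f :=
  GRing.isLinear.Build R {malg R[(V * W)%type]} U *:%R (free_ext f)
    (free_ext_is_linear f).

Lemma free_extU f v w : free_ext f << (v, w) >> = f v w.
Proof.
by rewrite (free_extEw _ msuppU_le) big_seq_fset1 mcoeffUU scale1r.
Qed.

End FreeExtension.

End Tensor.

(* The linear map sending the class of (v, w) to f v w; it is meaningful only
   for f bilinear (see tlift_tens). *)
HB.lock Definition tlift {R : comNzRingType} {V W U : lmodType R}
  (f : V -> W -> U) (t : tensor V W) : U := free_ext f (repr t).

Section Lift.
Context {R : comNzRingType}.
Variables V W U : lmodType R.
Implicit Type f : V -> W -> U.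

Lemma eq_tlift f g t : (forall v w, f v w = g v w) -> tlift f t = tlift g t.
Proof. by move=> fg; rewrite tlift.unlock; apply: eq_bigr => k _; rewrite fg. Qed.

Lemma tlift_fun_linear a f g t :
  tlift (fun v w => a *: f v w + g v w) t = a *: tlift f t + tlift g t.
Proof.
rewrite tlift.unlock /free_ext scaler_sumr -big_split; apply: eq_bigr => k _ /=.
by rewrite scalerDr !scalerA mulrC.
Qed.

Section Bilinear.
Variables (f : V -> W -> U) (f_bilinear : bilinear_for *:%R *:%R f).

Lemma free_ext_rel g : mspan (@tensor_rel R V W) g -> free_ext f g = 0.
Proof.
apply: (@mspan_min _ _ _ [set g | free_ext f g = 0]).
  split=> [|a u v /= fu fv]; first exact: linear0.
  by rewrite (free_ext_is_linear f) fu fv scaler0 addr0.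
have [fl fr] := f_bilinear.
have f0l w : f 0 w = 0 by have /= := fl w (-1) 0 0; rewrite scaler0 addr0 scaleN1r addNr.
have f0r v : f v 0 = 0 by have /= := fr v (-1) 0 0; rewrite scaler0 addr0 scaleN1r addNr.
move=> x [[[[v [v' [w ->]]]|[v [w [w' ->]]]]|[a [v [w ->]]]]|[a [v [w ->]]]] /=.
- rewrite !linearB /= !free_extU; have /= := fl w 1 v v'; rewrite !scale1r => ->.
  by rewrite addrAC addrK subrr.
- rewrite !linearB /= !free_extU; have /= := fr v 1 w w'; rewrite !scale1r => ->.
  by rewrite addrAC addrK subrr.
- rewrite linearB linearZ /= !free_extU; have /= := fl w a v 0.
  by rewrite f0l !addr0 => ->; rewrite subrr.
- rewrite linearB linearZ /= !free_extU; have /= := fr v a w 0.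
  by rewrite f0r !addr0 => ->; rewrite subrr.
Qed.

Lemma tlift_mpi g : tlift f (mpi (@tensor_rel R V W) g) = free_ext f g.
Proof.
apply/eqP; rewrite -subr_eq0 tlift.unlock -linearB; apply/eqP.
by apply: free_ext_rel; exact: repr_mpi.
Qed.

Lemma tlift_tens v w : tlift f (tens v w) = f v w.
Proof. by rewrite tlift_mpi free_extU. Qed.

Lemma tlift_is_linear : linear (tlift f).
Proof.
move=> a; apply: mquot_ind => g; apply: mquot_ind => h.
by rewrite -linearP !tlift_mpi linearP.
Qed.

End Bilinear.
End Lift.

Arguments tensor {R} (V W)%_type_scope.
Notation "V \ox W" := (tensor V W) (at level 40, left associativity)
  : type_scope.
Notation "v \ox w" := (tens v w) (at level 40, left associativity)
  : ring_scope.

Section TensorMaps.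
Context {R : comNzRingType}.

Section Map.
Variables V V' W W' : lmodType R.

Definition tmap (f : V -> V') (g : W -> W') : V \ox W -> V' \ox W' :=
  tlift (fun v w => f v \ox g w).

Variables (f : {linear V -> V'}) (g : {linear W -> W'}).

Lemma tmap_bilinear : bilinear_for *:%R *:%R (fun v w => f v \ox g w).
Proof.
by split=> [w a v v'|v a w w']; rewrite linearP ?tensDl ?tensDr ?tensZl ?tensZr.
Qed.

Lemma tmapE v w : tmap f g (v \ox w) = f v \ox g w.
Proof. exact: (tlift_tens tmap_bilinear). Qed.

HB.instance Definition _ :=
  GRing.isLinear.Build R (tensor V W) (tensor V' W') *:%R (tmap f g)
    (tlift_is_linear tmap_bilinear).

End Map.

Section Assoc.
Variables V W X : lmodType R.

Definition tassoc : (V \ox W) \ox X -> V \ox (W \ox X) :=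
  tlift (fun t x => tlift (fun v w => v \ox (w \ox x)) t).

Lemma tassoc_bilinear1 (x : X) :
  bilinear_for *:%R *:%R (fun (v : V) (w : W) => v \ox (w \ox x)).
Proof.
by split=> [w a v v'|v a w w']; rewrite ?tensDl ?tensDr ?tensZl ?tensZr.
Qed.

Lemma tassoc_bilinear : bilinear_for *:%R *:%R
  (fun (t : V \ox W) (x : X) => tlift (fun (v : V) (w : W) => v \ox (w \ox x)) t).
Proof.
split=> [x|t a x x']; first exact: (tlift_is_linear (tassoc_bilinear1 x)).
rewrite -tlift_fun_linear; apply: eq_tlift => v w.
by rewrite !tensDr !tensZr.
Qed.

Lemma tassocE (v : V) (w : W) (x : X) : tassoc ((v \ox w) \ox x) = v \ox (w \ox x).
Proof.
by rewrite /tassoc (tlift_tens tassoc_bilinear) (tlift_tens (tassoc_bilinear1 x)).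
Qed.

HB.instance Definition _ :=
  GRing.isLinear.Build R (tensor (tensor V W) X) (tensor V (tensor W X)) *:%R tassoc
    (tlift_is_linear tassoc_bilinear).

End Assoc.
End TensorMaps.

HB.lock Definition tens_mul {R : comNzRingType} {A B : algType R}
    (s t : A \ox B) : A \ox B :=
  tlift (fun a b => tlift (fun c d => (a * c) \ox (b * d)) t) s.

Section TensorRing.
Context {R : comNzRingType}.
Variables A B : algType R.
Implicit Types s t : A \ox B.

Lemma tens_mul_bilinear1 a b :
  bilinear_for *:%R *:%R (fun (c : A) (d : B) => (a * c) \ox (b * d)).
Proof.
by split=> [d k c c'|c k d d'];
  rewrite mulrDr -scalerAr ?tensDl ?tensDr ?tensZl ?tensZr.
Qed.

Lemma tens_mul_bilinear2 t : bilinear_for *:%R *:%R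
  (fun (a : A) (b : B) => tlift (fun c d => (a * c) \ox (b * d)) t).
Proof.
by split=> [b k a a'|a k b b']; rewrite -tlift_fun_linear;
  apply: eq_tlift => c d;
  rewrite mulrDl -scalerAl ?tensDl ?tensDr ?tensZl ?tensZr.
Qed.

Lemma tens_mulE (a c : A) (b d : B) :
  tens_mul (a \ox b) (c \ox d) = (a * c) \ox (b * d).
Proof.
by rewrite tens_mul.unlock (tlift_tens (tens_mul_bilinear2 _))
  (tlift_tens (tens_mul_bilinear1 _ _)).
Qed.

Lemma tens_mulDl : left_distributive (@tens_mul R A B) +%R.
Proof.
move=> s s' t; rewrite tens_mul.unlock -[s]scale1r.
by rewrite [LHS](tlift_is_linear (tens_mul_bilinear2 t)) !scale1r.
Qed.

Lemma tens_mulDr : right_distributive (@tens_mul R A B) +%R.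
Proof.
move=> s t t'; rewrite tens_mul.unlock -[X in _ = X + _]scale1r -tlift_fun_linear.
apply: eq_tlift => a b.
by have := tlift_is_linear (tens_mul_bilinear1 a b) 1 t t'; rewrite !scale1r.
Qed.

Lemma tens_mulA : associative (@tens_mul R A B).
Proof.
move=> x y z; move: x; apply: tens_ind => [a b|x x' IH IH']; last first.
  by rewrite !tens_mulDl IH IH'.
move: y; apply: tens_ind => [c d|y y' IH IH']; last first.
  by rewrite tens_mulDl !(tens_mulDr (a \ox b)) tens_mulDl IH IH'.
move: z; apply: tens_ind => [e f|z z' IH IH']; last first.
  rewrite (tens_mulDr (c \ox d)) (tens_mulDr (a \ox b)).
  by rewrite (tens_mulDr (tens_mul _ _)) IH IH'.
by rewrite !tens_mulE !mulrA.
Qed.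

Lemma tens_mul1r : left_id (1 \ox 1) (@tens_mul R A B).
Proof.
apply: tens_ind => [a b|x y IHx IHy]; first by rewrite tens_mulE !mul1r.
by rewrite tens_mulDr IHx IHy.
Qed.

Lemma tens_mulr1 : right_id (1 \ox 1) (@tens_mul R A B).
Proof.
apply: tens_ind => [a b|x y IHx IHy]; first by rewrite tens_mulE !mulr1.
by rewrite tens_mulDl IHx IHy.
Qed.

HB.instance Definition _ := GRing.Zmodule_isPzRing.Build (tensor A B)
  tens_mulA tens_mul1r tens_mulr1 tens_mulDl tens_mulDr.

Lemma tensM (a c : A) (b d : B) :
  (a \ox b) * (c \ox d) = (a * c) \ox (b * d).
Proof. exact: tens_mulE. Qed.

End TensorRing.

HB.mixin Record Algebra_isBialgebra (K : fieldType) B of GRing.Algebra K B := {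
  comul : {linear B -> (B \ox B)%type};
  counit : {scalar B};
  comulA : forall b : B,
    tassoc (tmap comul idfun (comul b)) = tmap idfun comul (comul b);
  comul_counitl : forall b : B,
    tlift (fun x y => counit x *: y) (comul b) = b;
  comul_counitr : forall b : B,
    tlift (fun x y => counit y *: x) (comul b) = b;
  comul_is_monoid_morphism : monoid_morphism comul;
  counit_is_monoid_morphism : monoid_morphism counit;
}.

#[short(type="bialgType")]
HB.structure Definition Bialgebra (K : fieldType) :=
  {B of GRing.Algebra K B & Algebra_isBialgebra K B}.

Definition principal_lideal (A : nzRingType) (a : A) : set A :=
  [set x * a | x in [set: A]].

(* As usual for perfect rings, the condition on the right is a descending chain
   condition on principal left ideals. *)
Definition right_perfect (A : nzRingType) : Prop :=
  forall a : nat -> A,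
    (forall n, principal_lideal (a n.+1) `<=` principal_lideal (a n)) ->
    exists N, forall n, (N <= n)%N ->
      principal_lideal (a n) = principal_lideal (a N).

Section Oslash.
Context {K : fieldType} (B : bialgType K).

Definition augmentation_ideal : set B := [set b | counit b = 0].

(* Products; [oslash] divides by their span, (B (x) B) Delta(B^+). *)
Definition oslash_rel : set (B \ox B)%type :=
  [set t * comul b | t in [set: (B \ox B)%type] & b in augmentation_ideal].

Definition oslash : Type := mquot oslash_rel.

HB.instance Definition _ := GRing.Lmodule.on oslash.

Definition iB (b : B) : oslash := mpi oslash_rel (b \ox 1).

(* x (x) y |-> sum of x_1 (x) y_1 (x) x_2 y_2 *)
Definition diag_coaction : B \ox B -> (B \ox B) \ox B :=
  tlift (fun x y : B =>
    tlift (fun x1 x2 : B =>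
      tlift (fun y1 y2 : B => (x1 \ox y1) \ox (x2 * y2)) (comul y))
      (comul x)).

Definition coinvariants : set (B \ox B)%type :=
  [set t | diag_coaction t = t \ox 1].

(* The map p_B is the restriction of [pB] to [coinvariants]. *)
Definition pB (t : B \ox B) : B := tlift (fun x y : B => counit y *: x) t.

End Oslash.

Arguments iB {K} B b.
Arguments coinvariants {K} B.
Arguments pB {K} B t.

(* Main.v *)
From HB Require Import structures.
Require Import Defs.
From mathcomp Require Import all_boot all_order all_algebra sesquilinear.
From mathcomp Require Import boolp classical_sets functions.

Set Implicit Arguments.
Unset Strict Implicit.
Unset Printing Implicit Defensive.

Import GRing.Theory.

Local Open Scope ring_scope.
Local Open Scope classical_set_scope.

(** Both claims rest on one consequence of perfectness: for every square matrix
    [X] over [B] there are [m] and [Y] with [X ^+ m = Y *m X ^+ m.+1]. By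
    Bjork's theorem ([bjork]) the chain condition on principal left ideals
    passes to finitely generated submodules of any left module, here to the
    left ideals of the matrix ring generated by the powers of [X]
    ([mx_power_stable]).

    Matrices come from the finiteness of comodules ([coideal_sum]): every
    element of [B \ox V] is a sum of [x i \ox y i] where the [x i] are a basis
    of a right coideal, so that [comul (x j)] is the sum of [x i \ox G i j] for
    a matrix [G]. This [G] is multiplicative: [comul (G i j)] is the sum of
    [G i k \ox G k j], its counit is the identity matrix, and its entries span
    a subspace that contains the coideal. If [G] had an inverse [S] over [B],
    an antipode on the coefficients, the class of [x \ox G i j] would be that
    of [x * S i j \ox 1], and a coinvariant sum of [x j \ox y j] would be
    determined by its image under [pB]. The matrix [Y] above is a substitute
    for [S] once enough powers of [G] can be cancelled, and each claim has its
    own cancellation.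

    For [iB], the class of the sum of [v_b \ox w_b] is unchanged when the row
    [v] is multiplied by [G] and the row [w] by the transpose of [G]
    ([pairing_mulmx]): the products contract to the [comul (G a d)], which act
    on classes through the counit. Hence [G ^+ m] can be inserted and
    [G ^+ m.+1] removed ([iB_image_comatrix]).

    For [pB], coinvariance of the sum of [x j \ox y j] says that the linear map
    [galois], sending [a \ox b] to [a_1 \ox (b * a_2)], carries the combination
    of the [y j] with coefficient row [v *m G] to the one with row [v]. Applying
    its iterates to a row of [G ^+ m = Z *m G ^+ m.+1] expresses [comul (y i)]
    as the sum of [y j \ox Z i j] ([comul_coinv]). If [pB] kills the
    coinvariant, then the counit kills all [y j], and therefore all [y j]
    vanish. *)

(** * Finitely generated submodules *)

Section Submodules.
Context {A : nzRingType} {M : lmodType A}.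
Implicit Types (L W : set M) (s : seq M).

Definition lsubmod W : Prop :=
  W 0 /\ forall a u v, W u -> W v -> W (a *: u + v).

Lemma lsubmodZ W a u : lsubmod W -> W u -> W (a *: u).
Proof. by move=> [W0 WP] Wu; rewrite -[_ *: _]addr0; exact: WP. Qed.

Lemma lsubmodD W u v : lsubmod W -> W u -> W v -> W (u + v).
Proof. by move=> [_ WP] Wu; move=> Wv; rewrite -[u]scale1r; exact: WP. Qed.

Lemma lsubmodB W u v : lsubmod W -> W u -> W v -> W (u - v).
Proof. by move=> Ws Wu Wv; rewrite -scaleN1r addrC; apply: (Ws.2). Qed.

Lemma lsubmodI L W : lsubmod L -> lsubmod W -> lsubmod (L `&` W).
Proof.
move=> [L0 LP] [W0 WP]; split=> // a u v [Lu Wu] [Lv Wv].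
by split; [exact: LP | exact: WP].
Qed.

(** The sum of [L] and the cyclic submodule generated by [x]. *)
Definition add_line L x : set M := [set v | exists c, L (v - c *: x)].

Lemma add_line_submod L x : lsubmod L -> lsubmod (add_line L x).
Proof.
move=> [L0 LP]; split; first by exists 0; rewrite scale0r subrr.
move=> a u v [c Lu] [d Lv]; exists (a * c + d).
rewrite scalerDl -scalerA opprD addrACA -scalerBr; exact: LP.
Qed.

Lemma sub_add_line L x : L `<=` add_line L x.
Proof. by move=> v Lv; exists 0; rewrite scale0r subr0. Qed.

Lemma mem_add_line L x : lsubmod L -> add_line L x x.
Proof. by move=> [L0 _]; exists 1; rewrite scale1r subrr. Qed.

Fixpoint lgen s : set M :=
  if s is x :: s' then add_line (lgen s') x else [set 0].

Lemma lgen_submod s : lsubmod (lgen s).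
Proof.
elim: s => [|x s IHs]; last exact: add_line_submod.
by split=> // a u v /= -> ->; rewrite scaler0 addr0.
Qed.

Lemma lgen_sub s W : lsubmod W -> (forall x, x \in s -> W x) -> lgen s `<=` W.
Proof.
move=> Ws; elim: s => [_ v ->|x s IHs sW v [c sv]]; first by case: Ws.
rewrite -(subrK (c *: x) v); apply: lsubmodD => //.
  by apply: IHs sv => y sy; apply: sW; rewrite inE sy orbT.
by apply: lsubmodZ => //; apply: sW; rewrite mem_head.
Qed.

Lemma mem_lgen s x : x \in s -> lgen s x.
Proof.
elim: s => // y s IHs; rewrite inE => /predU1P[->|/IHs sx].
  exact: mem_add_line (lgen_submod s).
exact: sub_add_line.
Qed.

(** A finitely generated submodule modulo the line through [x] comes from a
    finitely generated submodule: subtract a multiple of [x] from each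
    generator. *)
Lemma lgen_split s W x :
  lsubmod W -> (forall v, v \in s -> add_line W x v) ->
  exists2 l, lgen l `<=` W & lgen s `<=` add_line (lgen l) x.
Proof.
move=> Ws; elim: s => [_|y s IHs sW].
  exists [::]; first by move=> v ->; case: Ws.
  by move=> v sv; apply: sub_add_line.
have [|l lW sl] := IHs; first by move=> v sv; apply: sW; rewrite inE sv orbT.
have [c Wyc] := sW y (mem_head y s).
exists (y - c *: x :: l).
  apply: lgen_sub => // z; rewrite inE => /predU1P[-> //|lz].
  by apply: lW; exact: mem_lgen.
apply: lgen_sub; first exact: add_line_submod (lgen_submod _).
move=> z; rewrite inE => /predU1P[->|/mem_lgen/sl[d lz]].
  by exists c; apply: mem_lgen; rewrite mem_head.
by exists d; exact: sub_add_line.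
Qed.

(** Zorn's lemma for submodules that contain [W0] and satisfy a property stable
    under unions of chains. It serves twice: for the chain condition on
    finitely generated submodules, and to extend linear functionals. *)
Lemma maximal_submod (Q : set M -> Prop) W0 :
  lsubmod W0 -> Q W0 ->
  (forall F : set (set M), F !=set0 -> total_on F subset ->
    (forall X, F X -> lsubmod X /\ Q X) -> Q (\bigcup_(X in F) X)) ->
  exists L, [/\ lsubmod L, Q L, W0 `<=` L &
    forall L', lsubmod L' -> Q L' -> L `<=` L' -> L' `<=` L].
Proof.
move=> W0s QW0 Qchain.
pose good X := [/\ lsubmod X, Q X & W0 `<=` X].
(* The union of the empty chain is [set0], which is not a submodule: hence
   the first disjunct. *)
pose P X := X = set0 \/ good X.
have [F FP Ftot|L [PL Lmax]] := @Zorn_bigcup M P.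
  pose F' := [set X | F X /\ X !=set0].
  have eqU : \bigcup_(X in F) X = \bigcup_(X in F') X.
    apply/seteqP; split=> x [X FX Xx]; last by exists X => //; case: FX.
    by exists X => //; split=> //; exists x.
  have F'good X : F' X -> good X.
    by move=> [/FP[-> [x []]|]].
  have F'tot : total_on F' subset by move=> X Y [FX _] [FY _]; exact: Ftot.
  rewrite eqU; have [[X FX]|F'0] := pselect (F' !=set0); last first.
    left; apply/seteqP; split=> x // [X FX _]; by apply: F'0; exists X.
  right; split.
  - split; first by exists X => //; case: (F'good _ FX) => -[].
    move=> a u v [Y FY Yu] [Z FZ Zv].
    have [YZ|ZY] := F'tot _ _ FY FZ.
      exists Z => //; have [[_ ZP] _ _] := F'good _ FZ.
      by apply: ZP => //; exact: YZ.
    exists Y => //; have [[_ YP] _ _] := F'good _ FY.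
    by apply: YP => //; exact: ZY.
  - by apply: Qchain => //; [exists X | move=> Y /F'good[]].
  - by move=> w W0w; exists X => //; have [_ _] := F'good _ FX; apply.
case: PL => [L0|[Ls QL W0L]].
  have /Lmax[] : L `<` W0; last by right; split.
  by rewrite L0; split=> [w []|/(_ 0 W0s.1)].
exists L; split=> // L' L's QL' LL'; apply: contrapT => nL'L.
have /Lmax[] : L `<` L' by [].
by right; split=> // w /W0L /LL'.
Qed.

End Submodules.

(** * The chain condition on finitely generated submodules *)

Section Bjork.
Context {A : nzRingType}.
Hypothesis A_perfect : right_perfect A.

Section Module.
Context {M : lmodType A}.
Implicit Types (L W : set M) (s : seq M).

(** The products of the successive ratios [r k] generate a descending chain of
    principal left ideals; a repetition in it can be applied to [x 0]. *)
Lemma dcc_cyclic (x : nat -> M) :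
  (forall k, exists r, x k.+1 = r *: x k) -> exists k r, x k = r *: x k.+1.
Proof.
move=> /choice[r xS].
pose a := nat_rect (fun=> A) 1 (fun k ak => r k * ak).
have xa k : x k = a k *: x 0.
  by elim: k => [|k IHk]; rewrite ?scale1r // xS IHk scalerA.
have [k _ [y _ <-]|N aN] := A_perfect (a := a).
  by exists (y * r k) => //=; rewrite mulrA.
have : principal_lideal (a N) (a N) by exists 1; rewrite ?mul1r.
rewrite -(aN N.+1) // => -[y _ aNS].
by exists N, y; rewrite (xa N) (xa N.+1) scalerA aNS.
Qed.

(** Below a cyclic submodule that is not contained in [L] there is a minimal
    one; otherwise dependent choice yields a strictly descending chain. *)
Lemma minimal_line L x : ~ L x ->
  exists y, [/\ ~ L y, exists r, y = r *: x &
    forall r, ~ L (r *: y) -> exists c, y = c *: (r *: y)].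
Proof.
move=> nLx; apply: contrapT => none.
pose G y := ~ L y /\ exists r, y = r *: x.
have step y : exists y', G y ->
    [/\ G y', exists r, y' = r *: y & forall c, y <> c *: y'].
  have [[nLy [r yx]]|nG] := pselect (G y); last by exists y.
  have /existsNP[t /not_implyP[nLt /forallNP nt]] :
      ~ forall r, ~ L (r *: y) -> exists c, y = c *: (r *: y).
    by move=> min; apply: none; exists y; split=> //; exists r.
  exists (t *: y) => _; split=> //; last by exists t.
  by split=> //; exists (t * r); rewrite yx scalerA.
have [f fP] := choice step; pose z k := iter k f x.
have Gz k : G (z k).
  elim: k => [|k IHk] /=; last by case: (fP _ IHk).
  by split=> //; exists 1; rewrite scale1r.
have [k|k [c]] := @dcc_cyclic z; first by case: (fP _ (Gz k)).
by case: (fP _ (Gz k)) => _ _ /(_ c).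
Qed.

(** Asking for one repetition is enough: a chain that never became stationary
    would have a strictly descending subsequence. *)
Definition dcc_fg L : Prop := forall s : nat -> seq M,
  (forall k, lgen (s k) `<=` L) ->
  (forall k, lgen (s k.+1) `<=` lgen (s k)) ->
  exists k, lgen (s k) `<=` lgen (s k.+1).

(** The whole descending chain lies in its first term, whose finitely many
    generators lie in a single member of [F]. *)
Lemma dcc_fg_chain (F : set (set M)) :
  F !=set0 -> total_on F subset ->
  (forall X, F X -> lsubmod X /\ dcc_fg X) -> dcc_fg (\bigcup_(X in F) X).
Proof.
move=> [X0 FX0] Ftot FP s sU sS.
have [X FX s0X] : exists2 X, F X & lgen (s 0) `<=` X.
  have : forall x, x \in s 0 -> (\bigcup_(X in F) X) x.
    by move=> x sx; apply: (sU 0); exact: mem_lgen.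
  elim: (s 0) => [_|x t IHt tU].
    by exists X0 => // v ->; case: (FP _ FX0) => -[].
  have [|X FX tX] := IHt; first by move=> y ty; apply: tU; rewrite inE ty orbT.
  have [Y FY Yx] := tU x (mem_head x t).
  have [XY|YX] := Ftot _ _ FX FY; [exists Y|exists X] => //.
    apply: lgen_sub; first by case: (FP _ FY).
    by move=> y; rewrite inE => /predU1P[-> //|ty]; apply/XY/tX/mem_lgen.
  apply: lgen_sub; first by case: (FP _ FX).
  by move=> y; rewrite inE => /predU1P[->|ty]; [exact: YX | exact/tX/mem_lgen].
have [_ dX] := FP _ FX; apply: dX => // k.
by elim: k => // k IHk v /sS /IHk.
Qed.

(** The step of Bjork's theorem. If no term [V k] of the chain lies in [L],
    choose in each a [y k] outside [L] generating a minimal cyclic submodule.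
    As [(L + A x) / L] is simple, [V k] is the sum of [A y_k] and of a finitely
    generated submodule [lgen (l k)] of [L]. By minimality [y k] may be replaced
    there by [y k.+1] (claim [shift]), so that [l k.+1] can be chosen inside the
    submodule of [l k]. The chain condition in [L] makes [lgen (l k)] repeat,
    and then [V k] repeats. *)
Lemma dcc_fg_add_line L x : lsubmod L -> dcc_fg L -> ~ L x ->
  (forall r, ~ L (r *: x) -> exists c, x = c *: (r *: x)) ->
  dcc_fg (add_line L x).
Proof.
move=> Ls dL nLx xmin s sLx sS; pose V k := lgen (s k).
have Vs k : lsubmod (V k) by exact: lgen_submod.
have [[k VkL]|/forallNP VnL] := pselect (exists k, V k `<=` L).
  have [j|j|j] := dL (fun j => s (k + j)%N).
  - by elim: j => [|j IHj]; rewrite ?addn0 // addnS => v /sS /IHj.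
  - by rewrite addnS; exact: sS.
  - by rewrite addnS => VS; exists (k + j)%N.
have /choice[y yP] k : exists y, [/\ V k y, ~ L y &
    forall r, ~ L (r *: y) -> exists c, y = c *: (r *: y)].
  have /existsNP[v /not_implyP[Vv nLv]] := VnL k.
  have [y [nLy [r yv] ymin]] := minimal_line nLv.
  by exists y; split=> //; rewrite yv; exact: lsubmodZ.
(* [(L + A x) / L] is simple, hence generated by each [y k]. *)
have VLy k v : V k v -> add_line L (y k) v.
  move=> /sLx[r Lvr]; have [Vy nLy _] := yP k; have [t Lyt] := sLx _ _ Vy.
  have [|c xct] := xmin t.
    by move=> Ltx; apply: nLy; rewrite -(subrK (t *: x) (y k)); exact: lsubmodD.
  exists (r * c); have -> : v - (r * c) *: y k =
      (v - r *: x) - (r * c) *: (y k - t *: x).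
    rewrite scalerBr opprB addrA; congr (_ - _).
    by rewrite -scalerA -xct subrK.
  by apply: lsubmodB => //; exact: lsubmodZ.
pose P k l :=
  [/\ lgen l `<=` L, lgen l `<=` V k & V k `<=` add_line (lgen l) (y k)].
have shift k l : P k l -> V k `<=` add_line (lgen l) (y k.+1).
  move=> [lL lV Vl]; have [Vy nLy ymin] := yP k.+1.
  have [r lr] := Vl _ (sS _ _ Vy); have [_ _ ykmin] := yP k.
  (* [r *: y k] generates the same cyclic submodule as [y k], so [y k] is
     recovered from [y k.+1] modulo [lgen l]. *)
  have [|c ykc] := ykmin r.
    move=> Lr; apply: nLy; rewrite -(subrK (r *: y k) (y k.+1)).
    by apply: lsubmodD => //; exact: lL.
  move=> v /Vl[d lv]; exists (d * c).
  have -> : v - (d * c) *: y k.+1 =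
      (v - d *: y k) - (d * c) *: (y k.+1 - r *: y k).
    rewrite scalerBr opprB addrA; congr (_ - _).
    by rewrite -scalerA -ykc subrK.
  by apply: lsubmodB (lgen_submod l) lv _; apply: lsubmodZ (lgen_submod l) lr.
have restrict k W : lsubmod W -> W `<=` L ->
    V k `<=` add_line W (y k) -> exists2 l, P k l & lgen l `<=` W.
  move=> Ws WL VW; have [Vy _ _] := yP k.
  have [v /mem_lgen sv|l lW Vl] :=
    @lgen_split _ _ (s k) (W `&` V k) (y k) (lsubmodI Ws (Vs k)).
    have [c Wc] := VW v sv; exists c; split=> //.
    by apply: lsubmodB => //; exact: lsubmodZ.
  by exists l; [split=> // v /lW[] // /WL | move=> v /lW[]].
have [l0 Pl0 _] := restrict 0%N L Ls (@subset_refl _ _) (VLy 0%N).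
have /choice[f fP] (kl : nat * seq M) : exists l', P kl.1 kl.2 ->
    P kl.1.+1 l' /\ lgen l' `<=` lgen kl.2.
  case: kl => k l /=; have [Pkl|nP] := pselect (P k l); last by exists l.
  have [lL _ _] := Pkl.
  have [|l' Pl' l'l] := restrict k.+1 _ (lgen_submod l) lL.
    by move=> v /sS; exact: shift.
  by exists l'.
pose l := nat_rect (fun=> seq M) l0 (fun k lk => f (k, lk)).
have Pl k : P k (l k).
  by elim: k => // k IHk; case: (fP (k, l k) IHk).
have [k|k|k lk] := dL l; first by case: (Pl k).
  by case: (fP (k, l k) (Pl k)).
exists k => v /(shift _ _ (Pl k))[c lv]; have [_ lV _] := Pl k.+1.
have [Vy _ _] := yP k.+1.
rewrite -(subrK (c *: y k.+1) v); apply: lsubmodD (lgen_submod _) _ _.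
  exact/lV/lk.
exact: lsubmodZ (lgen_submod _) Vy.
Qed.

(** Bjork's theorem. A submodule maximal for [dcc_fg] cannot be proper, since a
    minimal cyclic submodule outside it could be added to it. *)
Theorem bjork : dcc_fg [set: M].
Proof.
have [|s sl _|F F0 Ftot FP|L [Ls dL _ Lmax]] :=
    @maximal_submod A M dcc_fg [set 0].
- exact: (@lgen_submod A M [::]).
- by exists 0%N => v /sl ->; case: (lgen_submod (s 1%N)).
- exact: dcc_fg_chain.
suff LT v : L v by move=> s _; apply: dL => k w _.
apply: contrapT => /minimal_line[x [nLx _ xmin]]; apply: (nLx).
apply: (Lmax (add_line L x)); first exact: add_line_submod.
- exact: dcc_fg_add_line.
- exact: sub_add_line.
- exact: mem_add_line.
Qed.

End Module.

(** The left ideals generated by the powers of [X] in the matrix ring are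
    finitely generated [A]-submodules of the module of matrices. *)
Lemma mx_power_stable n (X : 'M[A]_n) :
  exists m (Y : 'M[A]_n), X ^+ m = Y *m X ^+ m.+1.
Proof.
pose s k := [seq delta_mx p.1 p.2 *m X ^+ k | p : 'I_n * 'I_n].
have mxmul_submod (Z : 'M[A]_n) : lsubmod [set Y *m Z | Y in [set: 'M[A]_n]].
  split; first by exists 0 => //; rewrite mul0mx.
  move=> a _ _ [Y _ <-] [Y' _ <-]; exists (a *: Y + Y') => //.
  by rewrite mulmxDl scalemxAl.
have sE k : lgen (s k) = [set Y *m X ^+ k | Y in [set: 'M[A]_n]].
  apply/seteqP; split.
    by apply: lgen_sub => // _ /mapP[p _ ->]; exists (delta_mx p.1 p.2).
  move=> _ [Y _ <-]; rewrite {1}(matrix_sum_delta Y) pair_bigA mulmx_suml /=.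
  have := lgen_submod (s k); set V := lgen _ => Vs.
  elim/big_ind: _ => [|u v|p _]; [by case: Vs | exact: lsubmodD|].
  rewrite -scalemxAl; apply: lsubmodZ => //; apply: mem_lgen.
  by apply/mapP; exists p => //; rewrite mem_enum.
have [//|k|k] := @bjork 'M[A]_n s.
  by rewrite !sE => _ [Y _ <-]; exists (Y *m X) => //; rewrite exprS -mulmxA.
rewrite !sE => /(_ (X ^+ k))[]; first by exists 1%:M => //; rewrite mul1mx.
by move=> Y _ YX; exists k, Y.
Qed.

End Bjork.

(** * Tensor products over a field *)

Section LinearMaps.
Context {K : fieldType}.

Section Lifting.
Context {V W U : lmodType K}.

(** [tlift] packed with the bilinearity proof that makes it canonically linear. *)
Definition tensor_lift (f : V -> W -> U) of bilinear_for *:%R *:%R f :=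
  tlift f.

Context {f : V -> W -> U} (f_bilinear : bilinear_for *:%R *:%R f).

HB.instance Definition _ := GRing.isLinear.Build K (V \ox W)%type U *:%R
  (tensor_lift f_bilinear) (tlift_is_linear f_bilinear).

Lemma tensor_liftE v w : tensor_lift f_bilinear (v \ox w) = f v w.
Proof. exact: tlift_tens. Qed.

End Lifting.

Lemma eq_tensor (V W U : lmodType K) (f g : {linear (V \ox W)%type -> U}) :
  (forall v w, f (v \ox w) = g (v \ox w)) -> f =1 g.
Proof.
by move=> fg; apply: tens_ind => // x y fx fy; rewrite !linearD fx fy.
Qed.

Lemma tens0l (V W : lmodType K) (w : W) : (0 : V) \ox w = 0.
Proof. by rewrite -(scale0r 0) tensZl scale0r. Qed.

Lemma tens0r (V W : lmodType K) (v : V) : v \ox (0 : W) = 0.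
Proof. by rewrite -(scale0r 0) tensZr scale0r. Qed.

Lemma tens_suml (V W : lmodType K) n (v : 'I_n -> V) (w : W) :
  (\sum_i v i) \ox w = \sum_i v i \ox w.
Proof.

exact: (big_morph (fun u => u \ox w) (fun u u' => tensDl u u' w) (tens0l V w)).
Qed.

Lemma tens_sumr (V W : lmodType K) n (v : V) (w : 'I_n -> W) :
  v \ox (\sum_i w i) = \sum_i v \ox w i.
Proof. exact: (big_morph (fun w => v \ox w) (tensDr v) (tens0r W v)). Qed.

(** The two partial applications of the tensor symbol as named functions with a
    canonical linear structure. *)
Definition tens_at (V W : lmodType K) (w : W) (v : V) : V \ox W := v \ox w.

Lemma tens_atE (V W : lmodType K) (w : W) (v : V) : tens_at w v = v \ox w.
Proof. by []. Qed.

Lemma tens_at_linear (V W : lmodType K) (w : W) : linear (@tens_at V W w).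
Proof. by move=> a u v; rewrite /tens_at tensDl tensZl. Qed.

HB.instance Definition _ (V W : lmodType K) (w : W) :=
  GRing.isLinear.Build K V (V \ox W)%type *:%R (tens_at w) (tens_at_linear w).

Definition tens_by (V W : lmodType K) (v : V) (w : W) : V \ox W := v \ox w.

Lemma tens_by_linear (V W : lmodType K) (v : V) : linear (@tens_by V W v).
Proof. by move=> a u w; rewrite /tens_by tensDr tensZr. Qed.

HB.instance Definition _ (V W : lmodType K) (v : V) :=
  GRing.isLinear.Build K W (V \ox W)%type *:%R (tens_by v)
    (@tens_by_linear V W v).

Lemma sum_delta (V : lmodType K) n (v : 'I_n -> V) j :
  \sum_i (j == i)%:R *: v i = v j.
Proof.
rewrite (bigD1 j) //= eqxx scale1r big1 ?addr0 // => i /negPf ij.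
by rewrite eq_sym ij scale0r.
Qed.

Definition free_family (V : lmodType K) n (x : 'I_n -> V) : Prop :=
  forall c : 'I_n -> K, \sum_i c i *: x i = 0 -> forall i, c i = 0.

(** Let [L] be maximal among the subspaces that contain the [x j] with [j != i]
    and miss [x i]. Then [L] and the line of [x i] are complementary, and the
    coordinate along [x i] is the functional sought. *)
Lemma dual_functional (V : lmodType K) n (x : 'I_n -> V) (i : 'I_n) :
  free_family x ->
  exists2 f : V -> K, scalar f & forall j, f (x j) = (i == j)%:R.
Proof.
move=> x_free.
pose W0 := [set v | exists2 c : 'I_n -> K, c i = 0 & v = \sum_j c j *: x j].
have W0s : lsubmod W0.
  split; first by exists (fun=> 0); rewrite ?big1 // => j _; rewrite scale0r.
  move=> a _ _ [c ci ->] [d di ->]; exists (fun j => a * c j + d j).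
    by rewrite ci di mulr0 addr0.
  rewrite scaler_sumr -big_split; apply: eq_bigr => j _.
  by rewrite scalerDl scalerA.
have W0x : ~ W0 (x i).
  move=> [c ci xi]; have dx0 : \sum_j ((j == i)%:R - c j) *: x j = 0.
    under eq_bigr do rewrite scalerBl; rewrite sumrB -xi (bigD1 i) //= eqxx.
    rewrite scale1r big1 ?addr0 ?subrr // => j /negPf->; exact: scale0r.
  by have /eqP := x_free _ dx0 i; rewrite eqxx ci subr0 oner_eq0.
have [|L [Ls nLx W0L Lmax]] :=
    @maximal_submod _ V (fun L => ~ L (x i)) W0 W0s W0x.
  by move=> F _ _ FP [X FX Xx]; case: (FP X FX).
have LxT v : exists c, L (v - c *: x i).
  have [Lv|nLv] := pselect (L v); first by exists 0; rewrite scale0r subr0.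
  have [c Lxv] : add_line L v (x i).
    apply: contrapT => nx; apply: (nLv).
    exact: (Lmax _ (add_line_submod v Ls) nx (@sub_add_line _ _ _ _)
      _ (mem_add_line _ Ls)).
  have c0 : c != 0.
    by apply/eqP => c0; apply: nLx; move: Lxv; rewrite c0 scale0r subr0.
  exists c^-1; have := lsubmodZ (- c^-1) Ls Lxv.
  by rewrite scalerBr scalerA mulNr mulVf // scaleN1r scaleNr opprK addrC.
have /choice[f fP] := LxT.
have f_uniq v c : L (v - c *: x i) -> f v = c.
  move=> Lv; have [/eqP|d0] := eqVneq (f v - c) 0.
    by rewrite subr_eq0 => /eqP.
  case: nLx.
  have := lsubmodZ (f v - c)^-1 Ls (lsubmodB Ls Lv (fP v)).
  rewrite opprB [X in _ *: X]addrC addrA subrK -scalerBl scalerA mulVf //.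
  by rewrite scale1r.
exists f => [a u v|j]; apply: f_uniq.
  rewrite scalerDl -scalerA opprD addrACA -scalerBr; exact: Ls.2.
have [<-|ij] := eqVneq i j; first by rewrite scale1r subrr; case: Ls.
rewrite scale0r subr0; apply: W0L; exists (fun k => (k == j)%:R).
  by rewrite (negPf ij).
rewrite (bigD1 j) //= eqxx scale1r big1 ?addr0 // => k /negPf->.
by rewrite scale0r.
Qed.

Lemma scale_bilinear (V W : lmodType K) (f : V -> K) :
  scalar f -> bilinear_for *:%R *:%R (fun (v : V) (w : W) => f v *: w).
Proof.
move=> fl; split=> [w a v v'|v a w w'] /=; first by rewrite fl scalerDl scalerA.
by rewrite scalerDr !scalerA mulrC.
Qed.

Lemma scaler_bilinear (V W : lmodType K) (f : W -> K) :
  scalar f -> bilinear_for *:%R *:%R (fun (v : V) (w : W) => f w *: v).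
Proof.
move=> fl; split=> [w a v v'|v a w w'] /=; last by rewrite fl scalerDl scalerA.
by rewrite scalerDr !scalerA mulrC.
Qed.

Lemma free_tensor_coef (V W : lmodType K) n (x : 'I_n -> V) (z z' : 'I_n -> W) :
  free_family x -> \sum_i x i \ox z i = \sum_i x i \ox z' i -> z =1 z'.
Proof.
move=> x_free xz i; have [f fl fx] := dual_functional i x_free.
have fE (u : 'I_n -> W) :
    tensor_lift (scale_bilinear W fl) (\sum_j x j \ox u j) = u i.
  rewrite linear_sum (bigD1 i) //= tensor_liftE fx eqxx scale1r.
  rewrite big1 ?addr0 // => j /negPf ji.
  by rewrite tensor_liftE fx eq_sym ji scale0r.
by rewrite -[LHS]fE xz fE.
Qed.

Lemma tensor_sum (V W : lmodType K) (t : V \ox W) :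
  exists n (v : 'I_n -> V) (w : 'I_n -> W), t = \sum_i v i \ox w i.
Proof.
move: t; apply: tens_ind => [v w|_ _ [n [v [w ->]]] [m [v' [w' ->]]]].
  by exists 1%N, (fun=> v), (fun=> w); rewrite big_ord1.
exists (n + m)%N,
  (fun i => match fintype.split i with inl j => v j | inr j => v' j end),
  (fun i => match fintype.split i with inl j => w j | inr j => w' j end).
rewrite big_split_ord /=.
have splitl j : fintype.split (lshift m j) = inl j := unsplitK (inl j).
have splitr j : fintype.split (rshift n j) = inr j := unsplitK (inr j).
under [X in _ = X + _]eq_bigr do rewrite splitl.
by under [X in _ = _ + X]eq_bigr do rewrite splitr.
Qed.

Lemma not_free_solve (V : lmodType K) n (x : 'I_n.+1 -> V) : ~ free_family x ->
  exists i (c : 'I_n -> K), x i = \sum_j c j *: x (lift i j).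
Proof.
move=> /existsNP[c /not_implyP[cx /existsNP[i /eqP ci]]].
exists i, (fun j => - ((c i)^-1 * c (lift i j))).
move: cx; rewrite (bigD1_ord i) //= => /(congr1 ( *:%R (c i)^-1)).
rewrite scaler0 scalerDr scalerA mulVf // scale1r => /eqP.
rewrite addr_eq0 => /eqP->.
rewrite scaler_sumr -sumrN; apply: eq_bigr => j _.
by rewrite scalerA scaleNr.
Qed.

(** In an expression of [t] with the least number of terms, a linear relation
    on either side would allow one term to be absorbed into the others. *)
Lemma free_tensor_sum (V W : lmodType K) (t : V \ox W) :
  exists n (v : 'I_n -> V) (w : 'I_n -> W),
    [/\ free_family v, free_family w & t = \sum_i v i \ox w i].
Proof.
pose P n := `[< exists (v : 'I_n -> V) (w : 'I_n -> W),
  t = \sum_i v i \ox w i >].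
have [|n /asboolP[v [w tE]] nmin] := @ex_minnP P.
  by have [n ex] := tensor_sum t; exists n; exact/asboolP.
have shorter m : n = m.+1 ->
    ~ exists (v' : 'I_m -> V) (w' : 'I_m -> W), t = \sum_i v' i \ox w' i.
  by move=> nm short; have := nmin m (asboolT short); rewrite nm ltnn.
case: n v w tE {nmin} shorter => [|n] v w tE shorter.
  by exists 0%N, v, w; split=> // c _ [].
exists n.+1, v, w; split=> //; apply: contrapT => /not_free_solve[i [c ic]];
  apply: (shorter n erefl).
- exists (v \o lift i), (fun j => w (lift i j) + c j *: w i).
  rewrite tE (bigD1_ord i) //= ic tens_suml addrC -big_split /=.
  by apply: eq_bigr => j _; rewrite tensDr tensZl tensZr.
- exists (fun j => v (lift i j) + c j *: v i), (w \o lift i).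
  rewrite tE (bigD1_ord i) //= ic tens_sumr addrC -big_split /=.
  by apply: eq_bigr => j _; rewrite tensDl tensZl -tensZr.
Qed.

End LinearMaps.

(** * Coefficients of comodules *)

Section Coideals.
Context {K : fieldType} {C : lmodType K}.
Variables (comul : {linear C -> (C \ox C)%type}) (counit : {scalar C}).
Hypothesis comulA : forall b : C,
  tassoc (tmap comul idfun (comul b)) = tmap idfun comul (comul b).
Hypothesis comul_counitl : forall b : C,
  tlift (fun x y => counit x *: y) (comul b) = b.
Hypothesis comul_counitr : forall b : C,
  tlift (fun x y => counit y *: x) (comul b) = b.

Lemma counit_scalar : scalar counit.
Proof. exact: linearP. Qed.

Section FreeComodule.
Context {V : lmodType K}.

(** The left coaction of [C] on the cofree comodule [C \ox V]. *)
Definition coact (t : C \ox V) : C \ox (C \ox V) := tassoc (tmap comul idfun t).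

Lemma coact_linear : linear coact.
Proof. by move=> a s t; rewrite /coact !linearP. Qed.

HB.instance Definition _ := GRing.isLinear.Build K (C \ox V)%type
  (C \ox (C \ox V))%type *:%R coact coact_linear.

Lemma coactE b v : coact (b \ox v) = tassoc (comul b \ox v).
Proof. by rewrite /coact tmapE. Qed.


Lemma coact_counit t :
  tmap idfun (tensor_lift (scale_bilinear V counit_scalar)) (coact t) = t.
Proof.
set eps := tensor_lift _; move: t.
apply: (eq_tensor (f := tmap idfun eps \o coact) (g := idfun)) => b v /=.
rewrite coactE -{2}[b]comul_counitr.
pose eps' := tensor_lift (scaler_bilinear C counit_scalar).
change (tlift _ _) with (eps' (comul b)); move: (comul b).
apply: (eq_tensor (f := tmap idfun eps \o (@tassoc K C C V \o tens_at v))
  (g := tens_at v \o eps')) => p q /=.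
by rewrite !tens_atE tassocE tmapE /= /eps /eps' !tensor_liftE tensZl tensZr.
Qed.

End FreeComodule.

Lemma coact_coassoc (V : lmodType K) (t : C \ox V) :
  coact (coact t) = tmap idfun coact (coact t).
Proof.
move: t; apply: (eq_tensor (f := coact \o coact)
  (g := tmap idfun coact \o coact)) => b v /=.
pose assoc_at : {linear (C \ox C)%type -> _} := @tassoc K C C V \o tens_at v.
have coactl (s : C \ox C) : coact (tassoc (s \ox v)) =
    tmap idfun assoc_at (tassoc (tmap comul idfun s)).
  move: s; apply: (eq_tensor (f := coact \o assoc_at)
    (g := tmap idfun assoc_at \o
      (@tassoc K C C C \o tmap comul idfun))) => p q /=.
  rewrite !tens_atE tassocE coactE tmapE /=; move: (comul p).
  apply: (eq_tensor (f := @tassoc K C C _ \o tens_at (q \ox v))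
    (g := tmap idfun assoc_at \o (@tassoc K C C C \o tens_at q))) => p1 p2 /=.
  by rewrite !tens_atE !tassocE tmapE /= tens_atE tassocE.
have coactr (s : C \ox C) : tmap idfun coact (tassoc (s \ox v)) =
    tmap idfun assoc_at (tmap idfun comul s).
  move: s; apply: (eq_tensor (f := tmap idfun coact \o assoc_at)
    (g := tmap idfun assoc_at \o tmap idfun comul)) => p q /=.
  by rewrite !tens_atE tassocE !tmapE /= tens_atE coactE.
by rewrite coactE coactl comulA coactr.
Qed.

(** Finiteness of comodules: write [coact t] as a sum of [x i \ox w i] with both
    families free. Coassociativity, evaluated at a functional dual to [w j],
    expresses [comul (x j)] through the [x i]; thus the [x i] span a right
    coideal. Applying the counit to the middle factor of [coact t] gives [t]
    back. *)
Lemma coideal_sum (V : lmodType K) (t : C \ox V) :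
  exists n (x : 'I_n -> C) (y : 'I_n -> V) (G : 'M[C]_n),
    [/\ free_family x, t = \sum_i x i \ox y i &
      forall j, comul (x j) = \sum_i x i \ox G i j].
Proof.
have [n [x [w [x_free w_free tE]]]] := free_tensor_sum (coact t).
pose y i := tensor_lift (scale_bilinear V counit_scalar) (w i).
have /choice[f fP] (j : 'I_n) : exists f : C \ox V -> K,
    scalar f /\ forall k, f (w k) = (j == k)%:R.
  by have [f] := dual_functional j w_free; exists f.
have eval_bilin j := scaler_bilinear C (fP j).1.
pose eval j : {linear _ -> C} := tensor_lift (eval_bilin j).
exists n, x, y, (\matrix_(i, j) eval j (coact (w i))); split=> //.
  rewrite -[LHS]coact_counit tE linear_sum; apply: eq_bigr => i _.
  by rewrite /= tmapE.
move=> j; have evalE (s : C \ox C) u :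
    tmap idfun (eval j) (tassoc (s \ox u)) = f j u *: s.
  move: s; apply: (eq_tensor
    (f := tmap idfun (eval j) \o (@tassoc K C C _ \o tens_at u))
    (g := f j u \*: idfun)) => p q /=.
  by rewrite !tens_atE tassocE tmapE /= tensor_liftE tensZr.
pose F : {linear (C \ox (C \ox V))%type -> (C \ox C)%type} :=
  tmap idfun (eval j) \o coact.
have FE b u : F (b \ox u) = f j u *: comul b by rewrite /F /= coactE evalE.
pose H : {linear (C \ox (C \ox V))%type -> (C \ox C)%type} :=
  tmap idfun (eval j) \o tmap idfun coact.
have HE b u : H (b \ox u) = b \ox eval j (coact u) by rewrite /H /= !tmapE.
have : F (coact t) = H (coact t) by rewrite /F /H /= coact_coassoc.
clearbody F H; rewrite tE (linear_sum F) (linear_sum H).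
under eq_bigr do rewrite FE (fP j).2.
rewrite sum_delta => ->.
by apply: eq_bigr => i _; rewrite HE mxE.
Qed.

(** The coefficients of [comul] along a basis of a right coideal form a
    multiplicative matrix whose entries span the coideal and possibly more. *)
Section Comatrix.
Context {n : nat} {x : 'I_n -> C} {G : 'M[C]_n}.
Hypothesis x_free : free_family x.
Hypothesis comul_x : forall j, comul (x j) = \sum_i x i \ox G i j.

Lemma comul_comatrix i j : comul (G i j) = \sum_k G i k \ox G k j.
Proof.
have coact_x k : coact (x k \ox G k j) = \sum_i x i \ox (G i k \ox G k j).
  rewrite coactE comul_x tens_suml (linear_sum (@tassoc K C C C)).
  by apply: eq_bigr => i' _; exact: tassocE.
have assoc_x : coact (comul (x j)) = tmap idfun comul (comul (x j)).
  exact: comulA.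
have comul_G : tmap idfun comul (comul (x j)) = \sum_i x i \ox comul (G i j).
  rewrite comul_x (linear_sum (tmap idfun comul)).
  by apply: eq_bigr => k _; exact: (tmapE idfun comul).
have coact_G :
    coact (comul (x j)) = \sum_i x i \ox \sum_k G i k \ox G k j.
  rewrite comul_x (linear_sum (coact)).
  transitivity (\sum_k \sum_i x i \ox (G i k \ox G k j)).
    by apply: eq_bigr => k _; exact: coact_x.
  by rewrite exchange_big; apply: eq_bigr => k _; exact: esym (tens_sumr _ _).
have xG := etrans (esym comul_G) (etrans (esym assoc_x) coact_G).
exact: (free_tensor_coef x_free xG i).
Qed.

Lemma counit_comatrix i j : counit (G i j) = (i == j)%:R.
Proof.
apply/eqP; rewrite -subr_eq0; apply/eqP.
apply: (x_free (c := fun i => counit (G i j) - (i == j)%:R)).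
under eq_bigr do rewrite scalerBl eq_sym.
rewrite sumrB sum_delta; apply/eqP; rewrite subr_eq0; apply/eqP.
pose eps : {linear (C \ox C)%type -> C} :=
  tensor_lift (scaler_bilinear C (counit_scalar)).
have epsK : eps (comul (x j)) = x j := comul_counitr (x j).
rewrite -[RHS]epsK comul_x (linear_sum eps).
by apply: eq_bigr => k _; exact: esym (tensor_liftE _ _ _).
Qed.

Lemma comatrix_span j : x j = \sum_i counit (x i) *: G i j.
Proof.
pose eps : {linear (C \ox C)%type -> C} :=
  tensor_lift (scale_bilinear C (counit_scalar)).
have epsK : eps (comul (x j)) = x j := comul_counitl (x j).
rewrite -[LHS]epsK comul_x (linear_sum eps).
by apply: eq_bigr => k _; exact: tensor_liftE.
Qed.

End Comatrix.

End Coideals.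

(** * Left multiplication on the right tensor factor *)

Section RightMul.
Context {K : fieldType} {A : algType K}.

Definition lmul (a b : A) : A := a * b.

Lemma lmul_linear a : linear (lmul a).
Proof. by move=> k u v; rewrite /lmul mulrDr scalerAr. Qed.

HB.instance Definition _ a :=
  GRing.isLinear.Build K A A *:%R (lmul a) (lmul_linear a).

Definition mul_right (V : lmodType K) (a : A) :
  {linear (V \ox A)%type -> (V \ox A)%type} := tmap idfun (lmul a).

Lemma mul_rightE (V : lmodType K) a (v : V) b :
  mul_right V a (v \ox b) = v \ox (a * b).
Proof. exact: (tmapE idfun (lmul a)). Qed.

Lemma mul_right_linear (V : lmodType K) (t : V \ox A) :
  linear ((mul_right V)^~ t).
Proof.
move=> k a b /=.
apply: (eq_tensor (f := mul_right V (k *: a + b))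
  (g := (k \*: mul_right V a) \+ mul_right V b)) => v c.
by rewrite /= !mul_rightE mulrDl tensDr -scalerAl tensZr.
Qed.

Lemma mul_rightM (V : lmodType K) a b (t : V \ox A) :
  mul_right V (a * b) t = mul_right V a (mul_right V b t).
Proof.
apply: (eq_tensor (f := mul_right V (a * b))
  (g := mul_right V a \o mul_right V b)) => v c.
by rewrite /= !mul_rightE mulrA.
Qed.

Lemma mul_right1 (V : lmodType K) (t : V \ox A) : mul_right V 1 t = t.
Proof.
apply: (eq_tensor (f := mul_right V 1) (g := idfun)) => v c.
by rewrite mul_rightE mul1r.
Qed.

Lemma mul_scalar_tens (c : K) (t : A \ox A) : t * ((c%:A) \ox 1) = c *: t.
Proof.
move: t; apply: tens_ind => [a b|x y IHx IHy]; last first.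
  by rewrite mulrDl scalerDr IHx IHy.
by rewrite tensM mulr1 -scalerAr mulr1 tensZl.
Qed.

End RightMul.

(** * The map i_B is surjective *)

Section Bialgebra.
Context {K : fieldType} {B : bialgType K}.

Lemma bialg_coideal_sum (V : lmodType K) (t : B \ox V) :
  exists n (x : 'I_n -> B) (y : 'I_n -> V) (G : 'M[B]_n),
    [/\ free_family x, t = \sum_i x i \ox y i &
      forall j, comul (x j) = \sum_i x i \ox G i j].
Proof.
exact: (coideal_sum (@comulA K B) (@comul_counitr K B)).
Qed.

(** This is [coideal_sum] for the comodule [B] itself, with trivial factor [V]. *)
Lemma coideal_mem (b : B) :
  exists n (c : 'I_n -> K) (x : 'I_n -> B) (G : 'M[B]_n),
    [/\ free_family x, b = \sum_i c i *: x i &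
      forall j, comul (x j) = \sum_i x i \ox G i j].
Proof.
have [n [x [c [G [x_free bE comul_x]]]]] := bialg_coideal_sum (b \ox (1 : K^o)).
exists n, c, x, G; split=> //.
have id_scalar : scalar (fun k : K^o => k : K) by [].
pose eval : {linear (B \ox K^o)%type -> B} :=
  tensor_lift (scaler_bilinear B id_scalar).
have evalE a k : eval (a \ox k) = (k : K) *: a by exact: tensor_liftE.
rewrite -[LHS]scale1r -(evalE b 1) bE (linear_sum eval).
by apply: eq_bigr => i _; exact: evalE.
Qed.

Local Notation osl := (Defs.mpi (@oslash_rel K B)).

Lemma oslash_comul t b : osl (t * comul b) = osl (counit b *: t).
Proof.
apply/Defs.mpiP; apply: sub_mspan; exists t => //; exists (b - (counit b)%:A).
  rewrite /augmentation_ideal /= linearB linearZ /=.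
  rewrite (counit_is_monoid_morphism : monoid_morphism (@counit K B)).1.
  by rewrite mulr1 subrr.
rewrite linearB linearZ /=.
rewrite (comul_is_monoid_morphism : monoid_morphism (@comul K B)).1.
by rewrite mulrBr -tensZl mul_scalar_tens.
Qed.

Section Pairing.
Context {n : nat} {X : 'M[B]_n}.
Hypothesis comul_X : forall i j, comul (X i j) = \sum_k X i k \ox X k j.
Hypothesis counit_X : forall i j, counit (X i j) = (i == j)%:R.

Definition pairing (v w : 'rV[B]_n) : oslash B := osl (\sum_b v 0 b \ox w 0 b).

(** Summed over [b], the terms [(v 0 a * X a b) \ox (w 0 d * X b d)] give the
    left multiple of [comul (X a d)] by [v 0 a \ox w 0 d], whose class is that of
    [v 0 a \ox w 0 d] if [a = d] and zero otherwise. The transpose appears as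
    [b] is a column index in the first factor and a row index in the second. *)
Lemma pairing_mulmx v w : pairing (v *m X) (w *m X^T) = pairing v w.
Proof.
rewrite /pairing.
have -> : \sum_b (v *m X) 0 b \ox (w *m X^T) 0 b =
    \sum_a \sum_d (v 0 a \ox w 0 d) * comul (X a d).
  transitivity (\sum_b \sum_a \sum_d (v 0 a * X a b) \ox (w 0 d * X b d)).
    apply: eq_bigr => b _; rewrite !mxE tens_suml; apply: eq_bigr => a _.
    rewrite tens_sumr; apply: eq_bigr => d _.
    by rewrite mxE.
  rewrite exchange_big; apply: eq_bigr => a _.
  rewrite exchange_big; apply: eq_bigr => d _.
  rewrite comul_X mulr_sumr; apply: eq_bigr => b _.
  by rewrite tensM.
rewrite !linear_sum; apply: eq_bigr => a _.
rewrite linear_sum /= -[RHS](sum_delta (fun d => osl (v 0 a \ox w 0 d))).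
by apply: eq_bigr => d _; rewrite oslash_comul counit_X linearZ.
Qed.

Lemma pairing_mulmxX v w m :
  pairing (v *m X ^+ m) (w *m X^T ^+ m) = pairing v w.
Proof.
elim: m v w => [|m IHm] v w; first by rewrite !expr0 !mulmx1.
by rewrite !exprS !mulmxA IHm pairing_mulmx.
Qed.

End Pairing.
End Bialgebra.

Section Surjectivity.
Context {K : fieldType} {B : bialgType K}.
Hypothesis B_perfect : right_perfect B.

Local Notation osl := (Defs.mpi (@oslash_rel K B)).

Definition iB_image : set (oslash B) := [set z | exists b, iB B b = z].

Lemma iB_imageD z z' : iB_image z -> iB_image z' -> iB_image (z + z').
Proof.
move=> [b <-] [b' <-]; exists (b + b').
by rewrite /iB tensDl linearD.
Qed.

Lemma iB_imageZ c z : iB_image z -> iB_image (c *: z).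
Proof. by move=> [b <-]; exists (c *: b); rewrite /iB tensZl linearZ. Qed.

Lemma iB_image_sum n (z : 'I_n -> oslash B) :
  (forall i, iB_image (z i)) -> iB_image (\sum_i z i).
Proof.
move=> zI; elim/big_ind: _ => // [|]; last exact: iB_imageD.
by exists 0; rewrite /iB tens0l linear0.
Qed.

(** Let [X ^+ m = Y *m X ^+ m.+1] and write [e_i] for the rows of the identity
    matrix. The class of [b \ox X i j] is the pairing of [b e_i] and [e_j X^T].
    Multiplying by the [m]-th powers gives the pairing of [b e_i Y X ^+ m.+1]
    and [e_j X^T ^+ m.+1], which is the pairing of [b e_i Y] and [e_j], an
    element of the image of [iB]. *)
Lemma iB_image_comatrix n (X : 'M[B]_n) :
  (forall i j, comul (X i j) = \sum_k X i k \ox X k j) ->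
  (forall i j, counit (X i j) = (i == j)%:R) ->
  forall b i j, iB_image (osl (b \ox X i j)).
Proof.
move=> comul_X counit_X b i j.
have [m [Y XY]] := mx_power_stable B_perfect X.
have pairing_delta (v : 'rV[B]_n) : pairing v (delta_mx 0 j) = iB B (v 0 j).
  rewrite /pairing /iB (bigD1 j) //= big1 ?addr0 ?mxE ?eqxx // => k /negPf kj.
  by rewrite mxE kj andbF tens0r.
exists ((b *: (delta_mx 0 i : 'rV[B]_n) *m Y) 0 j).
rewrite -pairing_delta -(pairing_mulmxX comul_X counit_X _ _ m.+1).
rewrite -mulmxA -XY exprS mulmxA (pairing_mulmxX comul_X counit_X).
rewrite /pairing (bigD1 i) //= big1 ?addr0 => [|k /negPf ki].
  by rewrite -rowE !mxE !eqxx mulr1.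
by rewrite !mxE ki andbF mulr0 tens0l.
Qed.

Lemma iB_surj (z : oslash B) : exists b, iB B b = z.
Proof.
rewrite -[z]mpiK; move: (repr z) => t; rewrite -/(iB_image _).
move: t; apply: tens_ind => [a b|s t Is It]; last first.
  by rewrite linearD; exact: iB_imageD.
have [n [c [x [X [x_free -> comul_x]]]]] := coideal_mem b.
have comul_X := comul_comatrix (@comulA K B) x_free comul_x.
have counit_X := counit_comatrix (@comul_counitr K B) x_free comul_x.
rewrite tens_sumr linear_sum; apply: iB_image_sum => j.
rewrite tensZr linearZ; apply: iB_imageZ.
rewrite (comatrix_span (@comul_counitl K B) comul_x j) tens_sumr linear_sum.
apply: iB_image_sum => i; rewrite tensZr linearZ; apply: iB_imageZ.
exact: iB_image_comatrix.
Qed.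

End Surjectivity.

(** * The map p_B is injective on coinvariants *)

Section Injectivity.
Context {K : fieldType} {B : bialgType K}.
Hypothesis B_perfect : right_perfect B.

Lemma diag_bilinear2 (x1 x2 : B) : bilinear_for *:%R *:%R
  (fun y1 y2 : B => (x1 \ox y1) \ox (x2 * y2)).
Proof.
split=> [y2 k y1 y1'|y1 k y2 y2'] /=.
  by rewrite tensDr tensZr tensDl tensZl.
by rewrite mulrDr -scalerAr tensDr tensZr.
Qed.

Lemma diag_bilinear1 (t : B \ox B) : bilinear_for *:%R *:%R (fun x1 x2 : B =>
  tlift (fun y1 y2 : B => (x1 \ox y1) \ox (x2 * y2)) t).
Proof.
split=> [x2 k x1 x1'|x1 k x2 x2'] /=; rewrite -tlift_fun_linear;
  apply: eq_tlift => y1 y2.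
  by rewrite tensDl tensZl tensDl tensZl.
by rewrite mulrDl -scalerAl tensDr tensZr.
Qed.

Lemma diag_bilinear : bilinear_for *:%R *:%R (fun x y : B =>
  tlift (fun x1 x2 : B =>
    tlift (fun y1 y2 : B => (x1 \ox y1) \ox (x2 * y2)) (comul y)) (comul x)).
Proof.
split=> [y k x x'|x k y y'] /=.
  by rewrite linearP; exact: (tlift_is_linear (diag_bilinear1 (comul y))).
rewrite linearP -tlift_fun_linear; apply: eq_tlift => x1 x2.
exact: (tlift_is_linear (diag_bilinear2 x1 x2)).
Qed.

(** [diag_coaction] as a linear map. *)
Definition diag : {linear (B \ox B)%type -> ((B \ox B) \ox B)%type} :=
  tensor_lift diag_bilinear.

Lemma diagE n (x g : 'I_n -> B) a b : comul a = \sum_i x i \ox g i ->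
  tassoc (diag (a \ox b)) = \sum_i x i \ox mul_right B (g i) (comul b).
Proof.
move=> comul_a.
have -> : diag (a \ox b) = tensor_lift (diag_bilinear1 (comul b)) (comul a).
  exact: (tensor_liftE diag_bilinear).
rewrite comul_a (linear_sum (tensor_lift (diag_bilinear1 (comul b)))).
rewrite (linear_sum (@tassoc K B B B)); apply: eq_bigr => i _.
rewrite /= tensor_liftE.
apply: (eq_tensor
  (f := @tassoc K B B B \o tensor_lift (diag_bilinear2 (x i) (g i)))
  (g := tens_by (x i) \o mul_right B (g i))) => y1 y2 /=.
by rewrite tensor_liftE tassocE /tens_by mul_rightE.
Qed.

Lemma galois_bilinear : bilinear_for *:%R *:%R
  (fun a b : B => mul_right B b (comul a)).
Proof.
split=> [b k a a'|a k b b'] /=; first by rewrite !linearP.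
exact: mul_right_linear.
Qed.

(** The Galois-type map sending [a \ox b] to the sum of [a_1 \ox (b * a_2)]. *)
Definition galois : {linear (B \ox B)%type -> (B \ox B)%type} :=
  tensor_lift galois_bilinear.

Lemma galoisE a b : galois (a \ox b) = mul_right B b (comul a).
Proof. exact: (tensor_liftE galois_bilinear). Qed.

(** When [G] is the coefficient matrix of a free family [x], the condition
    [y_coinv] is the coinvariance of the sum of the [x i \ox y i]: compare the
    coefficients of [x i]. It makes [galois] undo the multiplication of [v] by
    [G] in [comb v]. *)
Section Columns.
Context {n : nat} (y : 'I_n -> B) (G : 'M[B]_n).
Hypothesis y_coinv : forall i, \sum_j galois (y j \ox G i j) = y i \ox 1.

Definition comb (v : 'rV[B]_n) : B \ox B := \sum_j y j \ox v 0 j.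

Lemma galois_comb v : galois (comb (v *m G)) = comb v.
Proof.
rewrite /comb (linear_sum galois).
transitivity (\sum_i mul_right B (v 0 i) (\sum_j galois (y j \ox G i j))).
  under [RHS]eq_bigr do rewrite (linear_sum (mul_right B _)).
  rewrite exchange_big; apply: eq_bigr => j _.
  rewrite mxE tens_sumr (linear_sum galois); apply: eq_bigr => i _.
  by rewrite /= !galoisE mul_rightM.
by apply: eq_bigr => i _; rewrite y_coinv mul_rightE mulr1.
Qed.

Lemma galois_combX v m : iter m galois (comb (v *m G ^+ m)) = comb v.
Proof.
elim: m v => [|m IHm] v; first by rewrite expr0 mulmx1.
by rewrite iterS exprSr mulmxA -iterS iterSr galois_comb.
Qed.

(** Put [e_i] for the [i]-th row of the identity. Apply [galois] [m.+1] times to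
    the combination of [y] with coefficients [e_i G ^+ m = z_i G ^+ m.+1],
    where [z_i] is the [i]-th row of [Z]. The left side gives
    [galois (y i \ox 1)], which is [comul (y i)], and the right side
    [comb z_i]. *)
Lemma comul_coinv m (Z : 'M[B]_n) i : G ^+ m = Z *m G ^+ m.+1 ->
  comul (y i) = comb (row i Z).
Proof.
move=> GZ; rewrite -(galois_combX (row i Z) m.+1) rowE -mulmxA -GZ iterS.
rewrite galois_combX /comb (bigD1 i) //= big1 ?addr0 => [|j /negPf ji].
  by rewrite galoisE mxE !eqxx mul_right1.
by rewrite mxE ji andbF tens0r.
Qed.

End Columns.

(** By linearity only the kernel matters. Write [t] as a sum of [x i \ox y i]
    with [x] free. Then [pB t = 0] means that the counit kills every [y i], and
    [comul_coinv] followed by the counit on the left factor shows that each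
    [y i] vanishes. *)
Lemma pB_inj : set_inj (coinvariants B) (pB B).
Proof.
pose p : {linear (B \ox B)%type -> B} :=
  tensor_lift (scaler_bilinear B (counit_scalar (@counit K B))).
have pE x y : p (x \ox y) = counit y *: x by exact: tensor_liftE.
suff ker t : diag t = t \ox 1 -> p t = 0 -> t = 0.
  move=> s t /set_mem /= cs /set_mem /= ct pst.
  apply/eqP; rewrite -subr_eq0; apply/eqP.
  have ds : diag s = s \ox 1 := cs; have dt : diag t = t \ox 1 := ct.
  apply: ker.
    rewrite linearB ds dt; exact: esym (linearB (tens_at (1 : B)) s t).
  by rewrite linearB; apply/eqP; rewrite subr_eq0; apply/eqP.
have [n [x [y [G [x_free tE comul_x]]]]] := bialg_coideal_sum t.
move=> t_coinv pt0; have [m [Z GZ]] := mx_power_stable B_perfect G.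
have eps_y i : counit (y i) = 0.
  apply: (x_free (fun i => counit (y i))); rewrite -[RHS]pt0 tE (linear_sum p).
  by apply: eq_bigr => j _; exact: esym (pE _ _).
have y_coinv i : \sum_j galois (y j \ox G i j) = y i \ox 1.
  apply: (free_tensor_coef (z := fun i => \sum_j galois (y j \ox G i j))
    (z' := fun i => y i \ox 1) x_free).
  transitivity (tassoc (diag t)).
    rewrite tE (linear_sum diag) (linear_sum (@tassoc K B B B)).
    transitivity (\sum_j \sum_i x i \ox galois (y j \ox G i j)).
      rewrite exchange_big; apply: eq_bigr => k _; exact: tens_sumr.
    apply: eq_bigr => j _; rewrite [RHS](diagE _ (comul_x j)).
    by apply: eq_bigr => k _; rewrite galoisE.
  rewrite t_coinv tE tens_suml (linear_sum (@tassoc K B B B)).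
  by apply: eq_bigr => k _; exact: tassocE.
have y0 i : y i = 0.
  pose eps : {linear (B \ox B)%type -> B} :=
    tensor_lift (scale_bilinear B (counit_scalar (@counit K B))).
  have epsK : eps (comul (y i)) = y i := comul_counitl (y i).
  rewrite -epsK (comul_coinv y_coinv i GZ) (linear_sum eps) big1 // => j _.
  have -> : eps (y j \ox row i Z 0 j) = counit (y j) *: row i Z 0 j.
    exact: tensor_liftE.
  by rewrite eps_y scale0r.
by rewrite tE big1 // => i _; rewrite y0 tens0r.
Qed.

End Injectivity.

Theorem proposition2p37 (K : fieldType) (B : bialgType K)
    (B_right_perfect : right_perfect B) :
  (forall z : oslash B, exists b : B, iB B b = z) /\
  set_inj (coinvariants B) (pB B).
Proof. by split; [exact: iB_surj | exact: pB_inj]. Qed.
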